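(* Let $G_1$ and $G_2$ be two $r$-uniform hypergraphs and let $p>r$. Then \[ \lambda^{(p)}(G_1\times G_2)=(r-1)!\,\lambda^{(p)}(G_1)\,\lambda^{(p)}(G_2). \]
   Context: An $r$-uniform hypergraph $G$ consists of a finite vertex set $V(G)$ and a set $E(G)$ of $r$-element subsets of $V(G)$ (edges). For $\bm{x}\in\mathbb{R}^{V(G)}$ let $P_G(\bm{x})=r\sum_{e\in E(G)}\prod_{v\in e}x_v$, and for real $p\ge1$ let $\|\bm{x}\|_p=(\sum_v|x_v|^p)^{1/p}$. The $p$-spectral radius of $G$ is $\lambda^{(p)}(G)=\max_{\|\bm{x}\|_p=1}P_G(\bm{x})$. The direct product $G_1\times G_2$ of two $r$-uniform hypergraphs is the $r$-uniform hypergraph with vertex set $V(G_1)\times V(G_2)$ in which $\{(i_1,j_1),\ldots,(i_r,j_r)\}$ is an edge if and only if $\{i_1,\ldots,i_r\}\in E(G_1)$ and $\{j_1,\ldots,j_r\}\in E(G_2)$. *)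

(* Defs.v *)
From HB Require Import structures.
From mathcomp Require Import all_boot all_order all_algebra.
From mathcomp Require Import all_classical all_reals all_analysis.

Set Implicit Arguments.
Unset Strict Implicit.
Unset Printing Implicit Defensive.

Import Order.TTheory GRing.Theory Num.Theory.
Import numFieldNormedType.Exports.

Local Open Scope classical_set_scope.
Local Open Scope ring_scope.

Record uhypergraph (r : nat) (V : finType) := UHypergraph {
  edges : {set {set V}};
  edges_uniform : forall e : {set V}, e \in edges -> #|e| = r }.

Definition direct_edges (r : nat) (V1 V2 : finType)
    (G1 : uhypergraph r V1) (G2 : uhypergraph r V2) : {set {set V1 * V2}} :=
  [set e : {set V1 * V2} |
    [exists i : {ffun 'I_r -> V1}, exists j : {ffun 'I_r -> V2},
      [&& e == [set (i k, j k) | k : 'I_r]%SET,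
          [set i k | k : 'I_r]%SET \in edges G1
        & [set j k | k : 'I_r]%SET \in edges G2]]].

Lemma direct_edges_uniform (r : nat) (V1 V2 : finType)
    (G1 : uhypergraph r V1) (G2 : uhypergraph r V2) (e : {set V1 * V2}) :
  e \in direct_edges G1 G2 -> #|e| = r.
Proof.
rewrite inE => /existsP[i /existsP[j /and3P[/eqP-> iE _]]].
have /imset_injP i_inj : #|[set i k | k : 'I_r]%SET| == #|'I_r|.
  by rewrite (edges_uniform iE) card_ord.
by rewrite card_in_imset ?card_ord// => k l kI lI [/(i_inj _ _ kI lI)].
Qed.

Definition direct_product (r : nat) (V1 V2 : finType)
    (G1 : uhypergraph r V1) (G2 : uhypergraph r V2) :
    uhypergraph r (V1 * V2)%type :=
  UHypergraph (@direct_edges_uniform r V1 V2 G1 G2).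

Definition Ppoly (R : realType) (r : nat) (V : finType) (G : uhypergraph r V)
    (x : V -> R) : R :=
  r%:R * \sum_(e in edges G) \prod_(v in e) x v.

Definition pnorm (R : realType) (V : finType) (p : R) (x : V -> R) : R :=
  (\sum_(v : V) `|x v| `^ p) `^ p^-1.

Definition sphere_values (R : realType) (p : R) (r : nat) (V : finType)
    (G : uhypergraph r V) : set R :=
  [set Ppoly G x | x in [set x : V -> R | pnorm p x = 1]].

(* The supremum is a maximum whenever [V] is nonempty and [1 <= p], see
   [pspectral_radius_max]; on the empty vertex set it is 0. *)
Definition pspectral_radius (R : realType) (p : R) (r : nat) (V : finType)
    (G : uhypergraph r V) : R :=
  sup (sphere_values p G).

Lemma continuous_normpowR (R : realType) (p : R) :
  1 <= p -> continuous (fun t : R => `|t| `^ p).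
Proof.
move=> p1 t; have p0 : 0 < p := lt_le_trans ltr01 p1.
have [->|t0] := eqVneq t 0.
  have nbr (d : R) : 0 < d -> \forall x \near (0 : R), `|x| < d.
    move=> d0; apply/nbhs_ballP; exists d => //= y.
    by rewrite /ball/= sub0r normrN.
  rewrite /continuous_at normr0 powR0 ?gt_eqF//.
  apply/cvgr0Pnorm_lt => e e0; near=> x.
  rewrite ger0_norm ?powR_ge0//.
  have x1 : `|x| < 1 by near: x; exact: nbr.
  have xe : `|x| < e by near: x; exact: nbr.
  have [->|x0] := eqVneq x 0; first by rewrite normr0 powR0 ?gt_eqF.
  by apply: le_lt_trans xe; apply: ge1r_powR => //; rewrite normr_gt0 x0 ltW.
have : derivable (fun y : R => y `^ p) `|t| 1.
  by apply: derivable_powR; rewrite in_itv/= normr_gt0 t0.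
move=> /derivable1_diffP/differentiable_continuous.
by apply: (@cvg_comp R R R (fun t => `|t|) (fun y => y `^ p) (nbhs t)
  (nbhs `|t|) (nbhs (`|t| `^ p))); exact: norm_continuous.
Unshelve. all: by end_near. Qed.

Lemma pnorm_eq1 (R : realType) (V : finType) (p : R) (x : V -> R) :
  1 <= p -> (pnorm p x = 1) <-> (\sum_(v : V) `|x v| `^ p = 1).
Proof.
move=> p1; have p0 : 0 < p := lt_le_trans ltr01 p1.
have s0 : 0 <= \sum_(v : V) `|x v| `^ p.
  by apply: sumr_ge0 => v _; apply: powR_ge0.
rewrite /pnorm; split=> [/eqP|->]; last by rewrite powR1.
by rewrite powR_eq1 ltNge s0/= invr_eq0 (gt_eqF p0) orbF => /eqP.
Qed.

Lemma pspectral_radius_max (R : realType) (p : R) (r : nat) (V : finType)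
    (G : uhypergraph r V) : (0 < #|V|)%N -> 1 <= p ->
  sphere_values p G (pspectral_radius p G) /\
  ubound (sphere_values p G) (pspectral_radius p G).
Proof.
move=> V0 p1; have p0 : 0 < p := lt_le_trans ltr01 p1.
pose h (u : 'rV[R]_#|V|) (v : V) : R := u ord0 (enum_rank v).
have hc v : continuous (h ^~ v) by move=> u; exact: coord_continuous.
pose s (u : 'rV[R]_#|V|) : R := \sum_(v : V) `|h u v| `^ p.
have sc : continuous s.
  move=> u; apply: (@cvg_big R V +%R 0 predT) => [||v _].
    exact: add_continuous.
    exact: nbhs_filter.
  apply: (@cvg_comp _ _ _ (h ^~ v) (fun t => `|t| `^ p) _ (nbhs (h u v))).
    exact: hc.
  exact: continuous_normpowR.
have Pc : continuous (fun u => Ppoly G (h u)).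
  have prodc (e : {set V}) : continuous (fun u => \prod_(v in e) h u v).
    move=> u; apply: (@cvg_big R V *%R 1 (mem e)) => [||v _].
      exact: mul_continuous.
      exact: nbhs_filter.
    exact: hc.
  have sumc : continuous (fun u => \sum_(e in edges G) \prod_(v in e) h u v).
    move=> u; apply: (@cvg_big R {set V} +%R 0 (mem (edges G))) => [||e _].
      exact: add_continuous.
      exact: nbhs_filter.
    exact: prodc.
  by move=> u; apply: (cvgM (cvg_cst _) (sumc u)).
pose A : set 'rV[R]_#|V| := [set u | s u = 1].
have Ac : compact A.
  have cubec := @rV_compact R #|V| (fun=> `[-1, 1]%classic)
    (fun=> @segment_compact _ (-1) 1).
  have Acl : closed A.
    by apply: (@preimage_closed _ _ s [set 1]) => //; exact: closed_eq.
  apply: subclosed_compact Acl cubec _.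
  move=> u su i; rewrite /= in_itv/= -ler_norml.
  have u1 : `|u ord0 i| `^ p <= 1.
    rewrite -[leRHS]su /s (bigD1 (enum_val i))//= /h enum_valK lerDl.
    by apply: sumr_ge0 => v _; exact: powR_ge0.
  rewrite leNgt; apply/negP => gt1; move: u1; apply/negP; rewrite -ltNge.
  exact: lt_le_trans (gt1) (le1r_powR (ltW gt1) p1).
have A0 : A !=set0.
  have /card_gt0P[v0 _] := V0.
  exists (\row_i (i == enum_rank v0)%:R); rewrite /A/= /s (bigD1 v0)//= big1.
    by rewrite /h mxE eqxx normr1 powR1 addr0.
  move=> v vv0; rewrite /h mxE (inj_eq enum_rank_inj) (negbTE vv0) normr0.
  by rewrite powR0 ?gt_eqF.
have [u uA umax] := EVT_max_rV A0 Ac (continuous_subspaceT Pc).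
have maxu : ubound (sphere_values p G) (Ppoly G (h u)).
  move=> _ [x /= /(pnorm_eq1 _ p1) x1 <-].
  pose w : 'rV[R]_#|V| := \row_i x (enum_val i).
  have hw : h w = x by apply/funext => v; rewrite /h mxE enum_rankK.
  by rewrite -hw; apply: umax; rewrite inE /A/= /s hw.
have inu : sphere_values p G (Ppoly G (h u)).
  by exists (h u) => //=; apply/(pnorm_eq1 _ p1); move: uA; rewrite inE.
suff -> : pspectral_radius p G = Ppoly G (h u) by [].
apply/eqP; rewrite eq_le; apply/andP; split.
  by apply: ge_sup => //; exists (Ppoly G (h u)).
by apply: ub_le_sup => //; exists (Ppoly G (h u)).
Qed.

(* Main.v *)
Require Import Defs.
From mathcomp Require Import all_boot all_order all_algebra.
From mathcomp Require Import all_classical all_reals all_analysis.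
From mathcomp Require Import ring.

(** Summing over ordered edges turns [(r - 1)! P_G] into the diagonal of a
symmetric [r]-linear form, and makes the form of [G1 x G2] an iterated one: the
sum over ordered edges [i] of [G1] of the form of [G2] at the slices
[x (i_k, _)]. Tensoring maximizers gives the lower bound. For the upper bound it
suffices that, for nonnegative [y_k] and [p >= r], the form of [G2] is at most
[(r - 1)! lambda (G2) prod_k ||y_k||_p], since then the remaining sum is
[(r - 1)! P_{G1}] at the unit vector [u |-> ||x (u, _)||_p]. That bound follows
by normalizing the [y_k], averaging over cyclic shifts of the slots and applying
weighted AM-GM, which replaces every slot by the [l^p]-mean of the [y_k]. *)

Set Implicit Arguments.
Unset Strict Implicit.

Import Order.TTheory GRing.Theory Num.Theory.
Local Open Scope ring_scope.

(** An edge has [r] elements, so such an [f] is injective: it is an ordering of an edge. *)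
Definition spans_edge (r : nat) (V : finType) (G : uhypergraph r V)
  (f : {ffun 'I_r -> V}) : bool := [set f k | k : 'I_r]%SET \in edges G.

Definition edge_form (R : realType) (r : nat) (V : finType)
    (G : uhypergraph r V) (y : 'I_r -> V -> R) : R :=
  \sum_(f | spans_edge G f) \prod_(k < r) y k (f k).

Lemma weighted_AGM (R : realType) (I : finType) (p : R) (a : I -> R) :
  (forall i, 0 <= a i) -> #|I|%:R <= p -> 0 < p ->
  p * \prod_i a i <= \sum_i a i `^ p + (p - #|I|%:R).
Proof.
move=> a0 Ip p0.
have [/existsP[i /eqP ai0]|/existsPn a_neq0] := boolP [exists i, a i == 0].
  rewrite (bigD1 i)//= ai0 mul0r mulr0 addr_ge0 ?subr_ge0//.
  by apply: sumr_ge0 => j _; exact: powR_ge0.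
have {}a0 i : 0 < a i by rewrite lt0r a0 andbT; exact: a_neq0.
pose S := \sum_i ln (a i).
have prodE : \prod_i a i = expR S.
  by rewrite expR_sum; apply: eq_bigr => i _; rewrite lnK// posrE.
(* The tangent line to [expR] at [S], evaluated at [p * ln (a i)] and at [0]. *)
have tangent (t : R) : expR S * (1 + t - S) <= expR t.
  rewrite -[in leRHS](subrKC S t) expRD ler_pM2l ?expR_gt0// -addrA.
  exact: expR_ge1Dx.
(* The weights total [p] and the terms in [S] cancel: with [m = #|I|],
   [m + p S - m S + (p - m)(1 - S) = p]. *)
have -> : p * \prod_i a i = expR S *
    (\sum_i (1 + p * ln (a i) - S) + (p - #|I|%:R) * (1 + 0 - S)).
  rewrite sumrB big_split/= -mulr_sumr !sumr_const -/S prodE -mulr_natl.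
  by rewrite -[S *+ _]mulr_natl; ring.
rewrite mulrDr mulr_sumr lerD//.
  by apply: ler_sum => i _; rewrite /powR gt_eqF//; exact: tangent.
rewrite mulrCA -[leRHS]mulr1 ler_wpM2l ?subr_ge0// -[leRHS]expR0.
exact: tangent.
Qed.

Lemma card_imset_inj (r : nat) (T : finType) (f : 'I_r -> T) :
  #|[set f k | k : 'I_r]%SET| = r -> injective f.
Proof.
move=> fr; have /imset_injP f_inj : #|[set f k | k : 'I_r]%SET| == #|'I_r|.
  by rewrite fr card_ord.
by move=> k l; exact: f_inj.
Qed.

(** A map from [r] indices has image [e] exactly when it is an injection into [e], and the
    injections are counted by a falling factorial. *)
Lemma card_spanning (r : nat) (V : finType) (e : {set V}) : #|e| = r ->
  #|[set f : {ffun 'I_r -> V} | [set f k | k : 'I_r]%SET == e]%SET| = r`!.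
Proof.
move=> er; rewrite -ffactnn -[in RHS]er -[X in (_ ^_ X)%N]card_ord.
rewrite er -[in X in (X ^_ _)%N]er -card_inj_ffuns_on; apply: eq_card => f.
rewrite !inE; apply/eqP/andP => [fe|[/ffun_onP fe /injectiveP f_inj]].
  split; first by apply/ffun_onP => k; rewrite -fe imset_f.
  by apply/injectiveP/card_imset_inj; rewrite fe.
apply/eqP; rewrite eqEcard card_imset// er card_ord leqnn andbT.
by apply/fintype.subsetP => _ /imsetP[k _ ->]; exact: fe.
Qed.

(** Each edge has [r! = (r - 1)! r] orderings with equal products; the factor [r] is the one built
    into [Ppoly]. *)
Lemma edge_form_diag (R : realType) (r : nat) (V : finType)
    (G : uhypergraph r V) (x : V -> R) : (0 < r)%N ->
  edge_form G (fun=> x) = (r.-1`!)%:R * Ppoly G x.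
Proof.
move=> r0; rewrite /Ppoly mulrA -natrM mulnC -[X in (X * _)%N](prednK r0).
rewrite -factS prednK// mulr_sumr /edge_form.
rewrite (partition_big (fun f : {ffun 'I_r -> V} => [set f k | k : 'I_r]%SET)
  (mem (edges G)))//.
apply: eq_bigr => e eG.
rewrite -(card_spanning (edges_uniform eG)) mulr_natl -sumr_const.
apply: eq_big => [f|f /andP[_ /eqP fe]]; rewrite ?inE /spans_edge.
  by rewrite andb_idl// => /eqP->.
rewrite -fe big_imset//=; apply: in2W; apply: card_imset_inj.
by rewrite fe (edges_uniform eG).
Qed.

(** Ordering decouples the product: the two coordinates of an ordered edge are chosen independently,
    whereas a pair of unordered edges yields [r!] edges of the product. *)
Lemma spans_edge_direct_product (r : nat) (V1 V2 : finType)
    (G1 : uhypergraph r V1) (G2 : uhypergraph r V2)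
    (f : {ffun 'I_r -> V1 * V2}) :
  spans_edge (direct_product G1 G2) f =
  spans_edge G1 [ffun k => (f k).1] &&
  spans_edge G2 [ffun k => (f k).2].
Proof.
rewrite /spans_edge /= inE; apply/existsP/andP => [[i /existsP[j]]|[f1 f2]].
  move=> /and3P[/eqP fij iG jG].
  have fE (T : finType) (h : V1 * V2 -> T) : [set h (f k) | k : 'I_r]%SET =
      [set h (i k, j k) | k : 'I_r]%SET.
    by rewrite (imset_comp h f) fij -imset_comp.
  split; [rewrite -[X in X \in _](_ : [set i k | k : 'I_r]%SET = _)//
         |rewrite -[X in X \in _](_ : [set j k | k : 'I_r]%SET = _)//].
    by rewrite -(fE _ fst); apply: eq_imset => k; rewrite ffunE.
  by rewrite -(fE _ snd); apply: eq_imset => k; rewrite ffunE.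
exists [ffun k => (f k).1]; apply/existsP; exists [ffun k => (f k).2].
rewrite f1 f2 !andbT; apply/eqP/eq_imset => k.
by rewrite !ffunE -surjective_pairing.
Qed.

Lemma edge_form_direct_product (R : realType) (r : nat) (V1 V2 : finType)
    (G1 : uhypergraph r V1) (G2 : uhypergraph r V2)
    (y : 'I_r -> V1 * V2 -> R) :
  edge_form (direct_product G1 G2) y =
  \sum_(i | spans_edge G1 i) edge_form G2 (fun k v => y k (i k, v)).
Proof.
rewrite /edge_form pair_big_dep/=.
pose pr (f : {ffun 'I_r -> V1 * V2}) :=
  ([ffun k => (f k).1] : {ffun 'I_r -> V1},
   [ffun k => (f k).2] : {ffun 'I_r -> V2}).
rewrite (reindex pr)/=; last first.
  exists (fun ij : {ffun 'I_r -> V1} * {ffun 'I_r -> V2} =>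
    [ffun k => (ij.1 k, ij.2 k)] : {ffun 'I_r -> V1 * V2}) => [f _|[i j] _].
    by apply/ffunP => k; rewrite !ffunE -surjective_pairing.
  by congr pair; apply/ffunP => k; rewrite !ffunE.
apply: eq_big => [f|f _]; first exact: spans_edge_direct_product.
by apply: eq_bigr => k _; rewrite !ffunE -surjective_pairing.
Qed.

Lemma edge_form_tensor (R : realType) (r : nat) (V1 V2 : finType)
    (G1 : uhypergraph r V1) (G2 : uhypergraph r V2)
    (x1 : V1 -> R) (x2 : V2 -> R) :
  edge_form (direct_product G1 G2) (fun=> fun v => x1 v.1 * x2 v.2) =
  edge_form G1 (fun=> x1) * edge_form G2 (fun=> x2).
Proof.
rewrite edge_form_direct_product /edge_form mulr_suml.
apply: eq_bigr => i _; rewrite mulr_sumr; apply: eq_bigr => j _.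
by rewrite -big_split.
Qed.

(** Reordering an ordered edge keeps its image, so composition with [s] permutes the index set of
    the sum. *)
Lemma edge_form_perm (R : realType) (r : nat) (V : finType)
    (G : uhypergraph r V) (y : 'I_r -> V -> R) (s : 'I_r -> 'I_r) :
  injective s -> edge_form G (fun k => y (s k)) = edge_form G y.
Proof.
move=> s_inj; rewrite /edge_form.
pose c (f : {ffun 'I_r -> V}) : {ffun 'I_r -> V} := [ffun k => f (s k)].
rewrite (reindex c)/=; last first.
  exists (fun f => [ffun k => f (invF s_inj k)]) => f _.
    by apply/ffunP => k; rewrite !ffunE f_invF.
  by apply/ffunP => k; rewrite !ffunE invF_f.
apply: eq_big => [f|f _].
  rewrite /spans_edge.
  suff -> : [set c f k | k : 'I_r]%SET = [set f k | k : 'I_r]%SET by [].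
  apply/setP => v.
  apply/imsetP/imsetP => -[k _ ->].
    by exists (s k) => //; rewrite ffunE.
  by exists (invF s_inj k) => //; rewrite ffunE f_invF.
by rewrite [RHS](reindex_inj s_inj)/=; apply: eq_bigr => k _; rewrite ffunE.
Qed.


Lemma powR_div (R : realType) (x y p : R) : 0 <= x -> 0 <= y ->
  (x / y) `^ p = x `^ p / y `^ p.
Proof.
move=> x0 y0; rewrite -powR_inv1// powRM ?powR_ge0// powRAC.
by rewrite powR_inv1 ?powR_ge0.
Qed.

(** Addition in ['I_n.+1] is cyclic, so as [c] varies each column [k] meets every row once. After
    division by the column means [w k], AM-GM for each [c] sums to
    [(n+1)^2 + (n+1)(p - n - 1) = (n+1) p]. *)
Lemma sum_prod_shift_le (R : realType) (n : nat) (p : R)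
    (b : 'I_n.+1 -> 'I_n.+1 -> R) :
  (forall l k, 0 <= b l k) -> n.+1%:R <= p ->
  \sum_c \prod_k b (k + c) k <=
  n.+1%:R * \prod_k ((\sum_l b l k `^ p) / n.+1%:R) `^ p^-1.
Proof.
move=> b0 np; have p0 : 0 < p by rewrite (lt_le_trans _ np)// ltr0Sn.
have bp0 k : 0 <= \sum_l b l k `^ p by apply: sumr_ge0 => l _; exact: powR_ge0.
pose w k := ((\sum_l b l k `^ p) / n.+1%:R) `^ p^-1.
rewrite -[X in _ * X]/(\prod_k w k).
have w0 k : 0 <= w k by exact: powR_ge0.
have wp k : w k `^ p = (\sum_l b l k `^ p) / n.+1%:R.
  by rewrite -powRrM mulVf ?gt_eqF// powRr1// divr_ge0.
(* A zero mean forces its whole column to vanish, and with it every product on the left. *)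
have [/existsP[k /eqP wk0]|/existsPn w_neq0] := boolP [exists k, w k == 0].
  rewrite big1 ?mulr_ge0 ?prodr_ge0// => c _; rewrite (bigD1 k)//=.
  suff -> : b (k + c) k = 0 by rewrite mul0r.
  have /esym/eqP := wp k; rewrite wk0 powR0; last by rewrite gt_eqF.
  rewrite mulf_eq0 invr_eq0 pnatr_eq0 orbF psumr_eq0 => [/allP bk0|l _].
    have := bk0 (k + c) (mem_index_enum _).
    by rewrite powR_eq0 => /andP[/eqP].
  exact: powR_ge0.
have {}w0 k : 0 < w k by rewrite lt0r w0 w_neq0.
rewrite (eq_bigr (fun c =>
    \prod_k w k * \prod_k (b (k + c) k / w k))); last first.
  move=> c _; rewrite -big_split/=; apply: eq_bigr => k _.
  by rewrite mulrC divfK// gt_eqF.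
rewrite -mulr_sumr mulrC ler_pM2r ?prodr_gt0// -(ler_pM2l p0) mulr_sumr.
apply: (@le_trans _ _ (\sum_(c < n.+1)
    (\sum_k (b (k + c) k / w k) `^ p + (p - n.+1%:R)))).
  apply: ler_sum => c _; rewrite -[in leRHS](card_ord n.+1).
  by apply: weighted_AGM; rewrite ?card_ord// => k; rewrite divr_ge0// ltW.
rewrite big_split/= exchange_big/= sumr_const card_ord.
rewrite (eq_bigr (fun=> n.+1%:R)); last first.
  (* The substitution [c = l - k] turns the sum over shifts into one over all of column [k], namely
     [(n+1) w_k^p]. *)
  move=> k _; rewrite (reindex_inj (addrI (- k)))/=.
  rewrite (eq_bigr (fun l => b l k `^ p / w k `^ p)) => [|l _].
    rewrite -mulr_suml wp invf_div mulrC divfK//.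
    apply: contraTneq (w0 k) => s0.
    by rewrite /w s0 mul0r powR0 ?ltxx// invr_eq0 gt_eqF.
  by rewrite addNKr powR_div// ltW.
by rewrite !sumr_const card_ord -mulrnDl subrKC mulr_natr.
Qed.

Lemma edge_form_le_diag (R : realType) (n : nat) (V : finType)
    (G : uhypergraph n.+1 V) (p : R) (y : 'I_n.+1 -> V -> R) :
  (forall k v, 0 <= y k v) -> n.+1%:R <= p ->
  edge_form G y <= edge_form G
    (fun=> fun v => ((\sum_k y k v `^ p) / n.+1%:R) `^ p^-1).
Proof.
move=> y0 np; rewrite -(ler_pM2l (ltr0Sn R n)).
have -> : n.+1%:R * edge_form G y =
    \sum_(c < n.+1) edge_form G (fun k => y (k + c)).
  rewrite (eq_bigr (fun=> edge_form G y)) => [|c _].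
    by rewrite sumr_const card_ord mulr_natl.
  by rewrite edge_form_perm//; exact: addIr.
rewrite exchange_big mulr_sumr; apply: ler_sum => f _.
exact: (@sum_prod_shift_le R n p (fun l k => y l (f k))).
Qed.

Lemma pnorm_powR (R : realType) (V : finType) (p : R) (x : V -> R) :
  0 < p -> pnorm p x `^ p = \sum_v `|x v| `^ p.
Proof.
move=> p0; rewrite /pnorm -powRrM mulVf ?gt_eqF// powRr1//.
by apply: sumr_ge0 => v _; exact: powR_ge0.
Qed.

Lemma pnorm_eq0 (R : realType) (V : finType) (p : R) (x : V -> R) :
  0 < p -> pnorm p x = 0 -> forall v, x v = 0.
Proof.
move=> p0 x0 v; have := pnorm_powR x p0.
rewrite x0 powR0; last by rewrite gt_eqF.
move=> /esym/eqP; rewrite psumr_eq0 => [/allP s0|u _]; last exact: powR_ge0.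
have := s0 v (mem_index_enum _).
by rewrite powR_eq0 normr_eq0 => /andP[/eqP].
Qed.

Lemma pnorm_normalize (R : realType) (V : finType) (p : R) (x : V -> R) :
  1 <= p -> 0 < pnorm p x -> pnorm p (fun v => x v / pnorm p x) = 1.
Proof.
move=> p1 x0; have p0 : 0 < p := lt_le_trans ltr01 p1.
apply/(pnorm_eq1 _ p1).
rewrite (eq_bigr (fun v => `|x v| `^ p / pnorm p x `^ p)) => [|v _].
  by rewrite -mulr_suml -pnorm_powR// divff// gt_eqF// powR_gt0.
by rewrite normrM normfV (gtr0_norm x0) powR_div// ltW.
Qed.

Lemma card_gt0_pnorm (R : realType) (V : finType) (p : R) (x : V -> R) :
  1 <= p -> pnorm p x = 1 -> (0 < #|V|)%N.
Proof.
move=> p1 /(pnorm_eq1 _ p1) x1; rewrite lt0n; apply/negP => /eqP/card0_eq V0.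
move: x1; rewrite big_pred0 => [/esym/eqP|v]; first by rewrite oner_eq0.
by have := V0 v; rewrite inE.
Qed.

Lemma Ppoly_le_pspectral_radius (R : realType) (p : R) (r : nat) (V : finType)
    (G : uhypergraph r V) (x : V -> R) :
  1 <= p -> pnorm p x = 1 -> Ppoly G x <= pspectral_radius p G.
Proof.
move=> p1 x1; have V0 : (0 < #|V|)%N := card_gt0_pnorm p1 x1.
by apply: (pspectral_radius_max G V0 p1).2; exists x.
Qed.

(** The absolute values of any unit vector form a unit vector at which [Ppoly] is nonnegative. *)
Lemma pspectral_radius_ge0 (R : realType) (p : R) (r : nat) (V : finType)
    (G : uhypergraph r V) : (0 < #|V|)%N -> 1 <= p ->
  0 <= pspectral_radius p G.
Proof.
move=> V0 p1; have [[x /= x1 _] _] := pspectral_radius_max G V0 p1.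
have {}x1 : pnorm p (fun v => `|x v|) = 1.
  by rewrite -x1 /pnorm; under eq_bigr do rewrite normr_id.
apply: le_trans (Ppoly_le_pspectral_radius G p1 x1).
by rewrite mulr_ge0// sumr_ge0// => e _; rewrite prodr_ge0.
Qed.

(** A Hölder-type bound for the multilinear form, reduced by homogeneity to slots of norm 1. *)
Lemma edge_form_le (R : realType) (n : nat) (V : finType)
    (G : uhypergraph n.+1 V) (p : R) (y : 'I_n.+1 -> V -> R) :
  (forall k v, 0 <= y k v) -> n.+1%:R <= p ->
  edge_form G y <=
  (n`!)%:R * pspectral_radius p G * \prod_k pnorm p (y k).
Proof.
move=> y0 np; have p1 : 1 <= p by rewrite (le_trans _ np)// ler1n.
have p0 : 0 < p := lt_le_trans ltr01 p1.
have [/existsP[k /eqP yk0]|/existsPn y_neq0] :=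
    boolP [exists k, pnorm p (y k) == 0].
  rewrite [X in _ <= _ * X](bigD1 k)//= yk0 mul0r mulr0.
  rewrite /edge_form big1// => f _.
  by rewrite (bigD1 k)//= (pnorm_eq0 p0 yk0) mul0r.
have {}y_gt0 k : 0 < pnorm p (y k) by rewrite lt0r y_neq0 powR_ge0.
pose z k v := y k v / pnorm p (y k).
have -> : edge_form G y =
    edge_form G z * \prod_k pnorm p (y k).
  rewrite /edge_form mulr_suml; apply: eq_bigr => f _.
  rewrite -big_split/=; apply: eq_bigr => k _.
  by rewrite divfK// gt_eqF.
rewrite ler_wpM2r ?prodr_ge0// => [k _|]; first exact: ltW.
have z0 k v : 0 <= z k v by rewrite divr_ge0// ltW.
apply: le_trans (edge_form_le_diag G z0 np) _.
rewrite edge_form_diag// ler_wpM2l//.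
apply: Ppoly_le_pspectral_radius => //; apply/(pnorm_eq1 _ p1).
(* The mean is again a unit vector: the [p]-th power of its norm averages those of the [z k]. *)
rewrite (eq_bigr (fun v => (\sum_k z k v `^ p) / n.+1%:R)) => [|v _].
  rewrite -mulr_suml exchange_big/= (eq_bigr (fun=> 1)) => [|k _].
    by rewrite sumr_const card_ord divff// pnatr_eq0.
  have /(pnorm_eq1 _ p1) <- := pnorm_normalize p1 (y_gt0 k).
  by apply: eq_bigr => v _; rewrite ger0_norm ?z0.
rewrite ger0_norm ?powR_ge0// -powRrM mulVf ?gt_eqF// powRr1// divr_ge0//.
by apply: sumr_ge0 => k _; exact: powR_ge0.
Qed.

Lemma pnorm_tensor (R : realType) (V1 V2 : finType) (p : R)
    (x1 : V1 -> R) (x2 : V2 -> R) : 1 <= p -> pnorm p x1 = 1 ->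
  pnorm p x2 = 1 -> pnorm p (fun v : V1 * V2 => x1 v.1 * x2 v.2) = 1.
Proof.
move=> p1 /(pnorm_eq1 _ p1) x1E /(pnorm_eq1 _ p1) x2E.
apply/(pnorm_eq1 _ p1).
rewrite -(pair_bigA _ (fun u v => `|x1 u * x2 v| `^ p))/=.
rewrite -[RHS]x1E; apply: eq_bigr => u _.
under eq_bigr do rewrite normrM powRM//.
by rewrite -mulr_sumr x2E mulr1.
Qed.

Unset Implicit Arguments.

Theorem theorem3p12 (R : realType) (r : nat) (r_gt0 : (0 < r)%N)
    (V1 V2 : finType) (G1 : uhypergraph r V1) (G2 : uhypergraph r V2)
    (p : R) (hp : r%:R < p) :
  pspectral_radius p (direct_product G1 G2)
    = ((r - 1)`!)%:R * pspectral_radius p G1 * pspectral_radius p G2.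
Proof.
case: r r_gt0 G1 G2 hp => // n _ G1 G2 /ltW np; rewrite subn1/=.
have p1 : 1 <= p by rewrite (le_trans _ np)// ler1n.
have p0 : 0 < p := lt_le_trans ltr01 p1.
have radius0 (V : finType) (G : uhypergraph n.+1 V) :
    #|V| = 0%N -> pspectral_radius p G = 0.
  move=> V0; rewrite /pspectral_radius (_ : sphere_values p G = set0) ?sup0//.
  rewrite -subset0 => _ [x /= x1 _].
  by have := card_gt0_pnorm p1 x1; rewrite V0.
(* With an empty factor the product is empty too, and both sides are the default supremum 0. *)
have [V10|] := posnP #|V1|.
  by rewrite (radius0 _ G1)// radius0 ?mulr0 ?mul0r// card_prod V10.
have [V20 _|V2_gt0 V1_gt0] := posnP #|V2|.
  by rewrite (radius0 _ G2)// radius0 ?mulr0// card_prod V20 muln0.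
have V_gt0 : (0 < #|{: V1 * V2}|)%N by rewrite card_prod muln_gt0 V1_gt0.
have nfact_gt0 : 0 < (n`!)%:R :> R by rewrite ltr0n fact_gt0.
apply/eqP; rewrite eq_le; apply/andP; split.
  have [[x /= x1 <-] _] := pspectral_radius_max (direct_product G1 G2) V_gt0 p1.
  (* Summing first over slices shows that the vector of slice norms has the same norm as [x]. *)
  pose X u := pnorm p (fun v => `|x (u, v)|).
  have X1 : pnorm p X = 1.
    apply/(pnorm_eq1 _ p1); have /(pnorm_eq1 _ p1) <- := x1.
    rewrite [RHS](eq_bigr (fun v => `|x (v.1, v.2)| `^ p)) => [|[]//].
    rewrite -(pair_bigA _ (fun u v => `|x (u, v)| `^ p))/=.
    apply: eq_bigr => u _; rewrite ger0_norm ?powR_ge0// pnorm_powR//.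
    by apply: eq_bigr => v _; rewrite normr_id.
  (* The extra factor [n!] turns [Ppoly] of the product into its edge form. *)
  rewrite -(ler_pM2l nfact_gt0) -[n in n`!]/(n.+1.-1) -edge_form_diag//.
  rewrite edge_form_direct_product.
  apply: (@le_trans _ _ (\sum_(i | spans_edge G1 i)
      (n`!)%:R * pspectral_radius p G2 * \prod_k X (i k))).
    apply: ler_sum => i _.
    apply: le_trans (edge_form_le G2
      (fun k v => normr_ge0 (x (i k, v))) np).
    apply: ler_sum => j _; rewrite -normr_prod; exact: ler_norm.
  rewrite -mulr_sumr -/(edge_form G1 (fun=> X)) edge_form_diag//=.
  rewrite mulrACA [leRHS](_ : _ =
    (n`!)%:R * (n`!)%:R * (pspectral_radius p G2 * pspectral_radius p G1)).
    rewrite ler_wpM2l ?mulr_ge0// ler_wpM2l ?pspectral_radius_ge0//.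
    exact: Ppoly_le_pspectral_radius.
  by ring.
(* Lower bound: the tensor product of two maximizers is an admissible unit vector. *)
have [[x1 /= x1E <-] _] := pspectral_radius_max G1 V1_gt0 p1.
have [[x2 /= x2E <-] _] := pspectral_radius_max G2 V2_gt0 p1.
apply: le_trans (Ppoly_le_pspectral_radius (direct_product G1 G2) p1
  (pnorm_tensor p1 x1E x2E)).
rewrite -(ler_pM2l nfact_gt0) -[n in leRHS]/(n.+1.-1) -edge_form_diag//.
rewrite edge_form_tensor !edge_form_diag//= le_eqVlt; apply/orP; left.
by apply/eqP; ring.
Qed.
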